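(* Let $n\ge 1$ be an integer and consider the Lissajous curve in $[-1,1]^3$ defined by $$ \boldsymbol{\ell}_n(\theta)=(\cos(a_n\theta),\cos(b_n\theta),\cos(c_n\theta)),\qquad \theta\in[0,\pi]. $$ Then for every polynomial $p\in\mathbb{P}_{2n}^3$, $$ \int_{[-1,1]^3} p(\boldsymbol{x})\,w(\boldsymbol{x})\,d\boldsymbol{x}=\pi^2\int_0^\pi p(\boldsymbol{\ell}_n(\theta))\,d\theta . $$
   Context: $\mathbb{P}_k^3$ denotes the space of trivariate polynomials of total degree not exceeding $k$. The product Chebyshev weight on $[-1,1]^3$ is $$w(\boldsymbol{x})=\frac{1}{\sqrt{(1-x_1^2)(1-x_2^2)(1-x_3^2)}}.$$ For each integer $n\ge1$, the integer triple $(a_n,b_n,c_n)$ is $$ (a_n,b_n,c_n)=\begin{cases} \left(\frac{3}{4}n^2+\frac{1}{2}n,\ \frac{3}{4}n^2+n,\ \frac{3}{4}n^2+\frac{3}{2}n+1\right), & n \text{ even},\\[4pt] \left(\frac{3}{4}n^2+\frac{1}{4},\ \frac{3}{4}n^2+\frac{3}{2}n-\frac{1}{4},\ \frac{3}{4}n^2+\frac{3}{2}n+\frac{3}{4}\right), & n \text{ odd}. \end{cases} $$ *)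

(* Defs.v *)
From HB Require Import structures.
From mathcomp Require Import all_boot all_order all_algebra.
From mathcomp Require Import all_classical all_reals all_analysis.
(* The notations of mpoly clash with those of MathComp-Analysis. *)
From mathcomp Require Import -(notations) mpoly.
From mathcomp Require Import ring.

Set Implicit Arguments.
Unset Strict Implicit.
Unset Printing Implicit Defensive.

Import Order.TTheory GRing.Theory Num.Theory.
Import numFieldNormedType.Exports.

Local Open Scope classical_set_scope.
Local Open Scope ring_scope.

Definition x1 (R : realType) (x : R * R * R) : R := x.1.1.
Definition x2 (R : realType) (x : R * R * R) : R := x.1.2.
Definition x3 (R : realType) (x : R * R * R) : R := x.2.

Definition lebesgue_measure3 (R : realType) :=
  ((@lebesgue_measure R \x @lebesgue_measure R) \x @lebesgue_measure R)%E.
Arguments lebesgue_measure3 : clear implicits.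

Definition cube (R : realType) : set (R * R * R) :=
  (`[-1, 1] `*` `[-1, 1]) `*` `[-1, 1].
Arguments cube : clear implicits.

(* [mmeasure mdeg p], also written [msize p], is the total degree plus one,
   and 0 for p = 0. *)
Definition deg_le (R : realType) (k : nat) (p : mpoly 3 R) : Prop :=
  (mmeasure mdeg p <= k.+1)%N.

Definition eval3 (R : realType) (p : mpoly 3 R) (x : R * R * R) : R :=
  meval (tnth [tuple x1 x; x2 x; x3 x]) p.

(* On the faces of the cube, a null set, the square root vanishes and the
   convention 0^-1 = 0 gives the value 0. *)
Definition chebyshev_weight (R : realType) (x : R * R * R) : R :=
  (Num.sqrt ((1 - x1 x ^+ 2) * (1 - x2 x ^+ 2) * (1 - x3 x ^+ 2)))^-1.

Definition freq_a (R : realType) (n : nat) : R :=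
  if odd n then 3 / 4 * n%:R ^+ 2 + 1 / 4
  else 3 / 4 * n%:R ^+ 2 + 1 / 2 * n%:R.

Definition freq_b (R : realType) (n : nat) : R :=
  if odd n then 3 / 4 * n%:R ^+ 2 + 3 / 2 * n%:R - 1 / 4
  else 3 / 4 * n%:R ^+ 2 + n%:R.

Definition freq_c (R : realType) (n : nat) : R :=
  if odd n then 3 / 4 * n%:R ^+ 2 + 3 / 2 * n%:R + 3 / 4
  else 3 / 4 * n%:R ^+ 2 + 3 / 2 * n%:R + 1.

Definition lissajous (R : realType) (n : nat) (theta : R) : R * R * R :=
  (cos (freq_a R n * theta), cos (freq_b R n * theta),
   cos (freq_c R n * theta)).

Lemma freq_nat (R : realType) (n : nat) :
  exists a b c : nat,
    [/\ freq_a R n = a%:R, freq_b R n = b%:R & freq_c R n = c%:R].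
Proof.
have := odd_double_half n; rewrite /freq_a /freq_b /freq_c -mul2n.
case: (odd n); rewrite /nat_of_bool; move: n./2 => m <-.
- exists (3 * (m * m) + 3 * m + 1)%N, (3 * (m * m) + 6 * m + 2)%N,
    (3 * (m * m) + 6 * m + 3)%N.
  by split; field.
- exists (3 * (m * m) + m)%N, (3 * (m * m) + 2 * m)%N,
    (3 * (m * m) + 3 * m + 1)%N.
  by split; field.
Qed.

(* Main.v *)
(* The substitution x = cos t in each variable turns the left-hand side for a
   monomial of exponents (i, j, k) into a product of three integrals of
   cos^i, cos^j, cos^k over [0, pi].  The identity cos(at) cos(Nt) =
   (cos((N+a)t) + cos((N-a)t)) / 2 reduces both this product and the integral
   along the curve, by the same recursion, to pure cosines of frequencies
   u, v, w, respectively ua + vb + wc, with |u| + |v| + |w| <= 2n.  The two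
   sides then agree because (a_n, b_n, c_n) has no nontrivial integer relation
   ua + vb + wc = 0 in that range. *)

Require Import Defs.
From HB Require Import structures.
From mathcomp Require Import all_boot all_order all_algebra.
From mathcomp Require Import all_classical all_reals all_analysis.
From mathcomp Require Import measurable_realfun.
From mathcomp Require Import -(notations) mpoly.
From mathcomp Require Import zify ring lra.

Import Order.TTheory GRing.Theory Num.Theory.
Import numFieldNormedType.Exports.

Local Open Scope classical_set_scope.
Local Open Scope ring_scope.

Set Implicit Arguments.
Unset Strict Implicit.

(** * Nonresonance of the frequencies *)

Lemma norm_lt_of_mul (m t c : int) : 0 < m -> `|m * t| < c * m -> `|t| < c.
Proof. by move=> m0; rewrite normrM (gtr0_norm m0) mulrC ltr_pM2r. Qed.

(** Two successive reductions leave a bounded search. Modulo m the relation forces w = m t; after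
    division by m, reduction modulo 3 m + 1 gives v = k (3 m + 1) - t (2 m + 1), and u follows. The
    size bound then confines t and k to finitely many values. *)
Lemma nonresonance_even (m u v w : int) : 1 <= m ->
  `|u| + `|v| + `|w| <= 4 * m ->
  u * (3 * (m * m) + m) + v * (3 * (m * m) + 2 * m)
    + w * (3 * (m * m) + 3 * m + 1) = 0 ->
  [/\ u = 0, v = 0 & w = 0].
Proof.
move=> m1 le4m eq0.
pose t := - (u * (3 * m + 1) + v * (3 * m + 2) + w * (3 * m + 3)).
have wE : w = m * t.
  by rewrite -[LHS]subr0 -eq0 /t; ring.
have {}eq0 : u * (3 * m + 1) + v * (3 * m + 2)
    + t * (3 * (m * m) + 3 * m + 1) = 0.
  have : m * (u * (3 * m + 1) + v * (3 * m + 2)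
    + t * (3 * (m * m) + 3 * m + 1)) = 0 by rewrite -[RHS]eq0 wE; ring.
  by move/eqP; rewrite mulf_eq0 => /orP[/eqP m0|/eqP//]; lia.
pose k := - (u + v + t * m).
have vE : v = k * (3 * m + 1) - t * (2 * m + 1).
  by rewrite -[LHS]subr0 -eq0 /k; ring.
have uE : u = t * (m + 1) - k * (3 * m + 2).
  have -> : u = - k - t * m - v by rewrite /k; ring.
  by rewrite vE; ring.
clearbody t k.
have t4 : `|t| < 5 by apply: (@norm_lt_of_mul m); lia.
have k4 : `|k| < 5 by apply: (@norm_lt_of_mul (3 * m + 1)); lia.
(* Once t and k are numerals, u, v and w are affine in m, so each of the 81 cases is linear
   arithmetic. *)
have : t \in [:: -4; -3; -2; -1; 0; 1; 2; 3; 4] by rewrite !inE; lia.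
have : k \in [:: -4; -3; -2; -1; 0; 1; 2; 3; 4] by rewrite !inE; lia.
rewrite !inE => /or4P[||| /or4P[||| /or3P[]]] /eqP kE;
  move=> /or4P[||| /or4P[||| /or3P[]]] /eqP tE; subst t k; split; lia.
Qed.

(** With s = u + v + w and t = u - m s, the relation becomes u - v = 3 m t, so u, v and w are
    determined by s and t. The size bound gives |t| <= 1, and then m s = u - t gives |s| <= 3. *)
Lemma nonresonance_odd (m u v w : int) : 1 <= m ->
  `|u| + `|v| + `|w| <= 4 * m - 2 ->
  u * (3 * (m * m) - 3 * m + 1) + v * (3 * (m * m) - 1)
    + w * (3 * (m * m)) = 0 ->
  [/\ u = 0, v = 0 & w = 0].
Proof.
move=> m1 le4m eq0.
pose s := u + v + w.
pose t := u - m * s.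
have uE : u = m * s + t by rewrite /t; ring.
have vE : v = m * s + t - 3 * (m * t).
  by rewrite -uE -[LHS]addr0 -eq0 /t /s; ring.
have wE : w = s - 2 * (m * s) - 2 * t + 3 * (m * t).
  have -> : w = s - u - v by rewrite /s; ring.
  by rewrite {1}uE vE; ring.
clearbody t s.
have t1 : `|t| < 2 by apply: (@norm_lt_of_mul m); lia.
have s3 : `|s| < 4 by apply: (@norm_lt_of_mul m); lia.
have : t \in [:: -1; 0; 1] by rewrite !inE; lia.
have : s \in [:: -3; -2; -1; 0; 1; 2; 3] by rewrite !inE; lia.
rewrite !inE => /or4P[||| /or4P[]] /eqP sE;
  move=> /or3P[] /eqP tE; subst s t; split; lia.
Qed.

(** * Moments of cosines *)

Section CosineMoments.
Variable R : realType.
Local Notation mu := (@lebesgue_measure R).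
Implicit Types (g : R -> R) (A B : R).

Lemma continuous_integrable_itv g A B : continuous g ->
  mu.-integrable `[A, B] (EFin \o g).
Proof.
move=> cg; apply: continuous_compact_integrable; first exact: segment_compact.
exact: continuous_subspaceT.
Qed.

Lemma continuous_cosM A : continuous (fun x : R => cos (A * x)).
Proof.
move=> x; apply: (@continuous_comp _ _ _ (fun x => A * x) (@cos R)).
  exact: mulrl_continuous.
exact: continuous_cos.
Qed.

Lemma continuous_mul g1 g2 : continuous g1 -> continuous g2 ->
  continuous (fun x => g1 x * g2 x).
Proof. by move=> c1 c2 x; apply: continuousM; [exact: c1|exact: c2]. Qed.

Lemma continuous_expn g n : continuous g -> continuous (fun x => g x ^+ n).
Proof.
move=> cg; elim: n => [|n ih].
  by under eq_fun do rewrite expr0; exact: cst_continuous.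
by under eq_fun do rewrite exprS; exact: continuous_mul.
Qed.

Lemma Rintegral_mul_cos_cos g A B : continuous g ->
  \int[mu]_(x in `[0, pi]) (g x * (cos (A * x) * cos (B * x))) =
  2^-1 * (\int[mu]_(x in `[0, pi]) (g x * cos ((B + A) * x)) +
          \int[mu]_(x in `[0, pi]) (g x * cos ((B - A) * x))).
Proof.
move=> cg; rewrite -RintegralD//; last 2 first.
- by apply: continuous_integrable_itv; apply: continuous_mul => //;
    exact: continuous_cosM.
- by apply: continuous_integrable_itv; apply: continuous_mul => //;
    exact: continuous_cosM.
rewrite -RintegralZl//; last first.
  apply: continuous_integrable_itv => x.
  apply: cvgD; apply: continuous_mul => //; exact: continuous_cosM.
apply: eq_Rintegral => x _.
by rewrite mulrDl mulrBl cosD cosB; field.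
Qed.

Lemma sin_natmul_pi (n : nat) : sin (n%:R * pi) = 0 :> R.
Proof.
elim: n => [|n ih]; first by rewrite mul0r sin0.
by rewrite mulrSr mulrDl mul1r sinD ih sinpi mul0r mulr0 addr0.
Qed.

Lemma sin_intmul_pi (n : int) : sin (n%:~R * pi) = 0 :> R.
Proof.
case: n => n; first exact: sin_natmul_pi.
by rewrite NegzE mulrNz mulNr sinN -pmulrn sin_natmul_pi oppr0.
Qed.

Lemma Rintegral_cos_intmul (n : int) :
  \int[mu]_(x in `[0, pi]) cos (n%:~R * x) = if n == 0 then pi else 0 :> R.
Proof.
case: eqP => [->|/eqP n0].
  under eq_Rintegral do rewrite mul0r cos0.
  by rewrite Rintegral_cst// [X in fine X](lebesgue_measure_itv `[0, pi]) /=
    lte_fin pi_gt0/= subr0 mul1r.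
have nR0 : (n%:~R : R) != 0 by rewrite intr_eq0.
pose F (x : R) : R := n%:~R^-1 * sin (n%:~R * x).
have dF (x : R) : is_derive x 1 F (cos (n%:~R * x)).
  rewrite /F; apply: is_derive_eq.
  by rewrite /GRing.scale /= mulr1; field.
have cF : continuous F.
  by move=> x; apply/differentiable_continuous/derivable1_diffP.
rewrite /Rintegral (@continuous_FTC2 _ _ F).
- by rewrite /F sin_intmul_pi !mulr0 sin0 mulr0 -EFinB subrr.
- exact: pi_gt0.
- by apply: continuous_subspaceT; exact: continuous_cosM.
- split => // [|]; [apply: cvg_at_right_filter|apply: cvg_at_left_filter];
    exact: cF.
- by move=> x _; rewrite derive1E derive_val.
Qed.

(** Up to normalisation, a Fourier cosine coefficient of cos^i. Only u = 0 occurs in the final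
    identity; the general frequency is what makes the recursion on i close. *)
Definition cos_moment (i : nat) (u : int) : R :=
  \int[mu]_(x in `[0, pi]) (cos x ^+ i * cos (u%:~R * x)).

Lemma cos_momentS i u :
  cos_moment i.+1 u = 2^-1 * (cos_moment i (u + 1) + cos_moment i (u - 1)).
Proof.
rewrite /cos_moment.
(* The last factor cos x is written cos (1 * x), so that the product-to-sum formula applies with A =
   1. *)
under eq_Rintegral => x _ do rewrite exprSr -mulrA -{2}[x]mul1r.
rewrite Rintegral_mul_cos_cos; last first.
  by apply: continuous_expn; exact: continuous_cos.
by rewrite intrD intrB.
Qed.

(** * Moments along a curve with nonresonant frequencies *)

Section lissajous_moments.
Variables (a b c : int) (d : nat).
Hypothesis nonresonant : forall u v w : int,
  (`|u| + `|v| + `|w| <= d)%N -> u * a + v * b + w * c = 0 ->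
  [/\ u = 0, v = 0 & w = 0].

Let L i j k (N : int) : R := \int[mu]_(x in `[0, pi])
  (cos (a%:~R * x) ^+ i * cos (b%:~R * x) ^+ j * cos (c%:~R * x) ^+ k *
   cos (N%:~R * x)).

Let continuous_prod3 i j k : continuous (fun x : R => cos (a%:~R * x) ^+ i *
  cos (b%:~R * x) ^+ j * cos (c%:~R * x) ^+ k).
Proof.
by do ![apply: continuous_mul]; apply: continuous_expn; exact: continuous_cosM.
Qed.

Let L1 i j k N : L i.+1 j k N = 2^-1 * (L i j k (N + a) + L i j k (N - a)).
Proof.
rewrite /L intrD intrB -(@Rintegral_mul_cos_cos (fun x => cos (a%:~R * x) ^+ i *
  cos (b%:~R * x) ^+ j * cos (c%:~R * x) ^+ k)); last exact: continuous_prod3.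
by apply: eq_Rintegral => x _; rewrite exprS; ring.
Qed.

Let L2 i j k N : L i j.+1 k N = 2^-1 * (L i j k (N + b) + L i j k (N - b)).
Proof.
rewrite /L intrD intrB -(@Rintegral_mul_cos_cos (fun x => cos (a%:~R * x) ^+ i *
  cos (b%:~R * x) ^+ j * cos (c%:~R * x) ^+ k)); last exact: continuous_prod3.
by apply: eq_Rintegral => x _; rewrite exprS; ring.
Qed.

Let L3 i j k N : L i j k.+1 N = 2^-1 * (L i j k (N + c) + L i j k (N - c)).
Proof.
rewrite /L intrD intrB -(@Rintegral_mul_cos_cos (fun x => cos (a%:~R * x) ^+ i *
  cos (b%:~R * x) ^+ j * cos (c%:~R * x) ^+ k)); last exact: continuous_prod3.
by apply: eq_Rintegral => x _; rewrite exprS; ring.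
Qed.

(** Both sides obey the same recursion: lowering i, j or k by one shifts u, v or w by 1 in either
    direction, which preserves the bound by d. At exponents 0 both sides are pi^3 or 0; the factor
    pi^2 compensates for one integral facing three. *)
Lemma Rintegral_lissajous_moment i j k (u v w : int) :
  (i + j + k + (`|u| + `|v| + `|w|) <= d)%N ->
  pi ^+ 2 * \int[mu]_(x in `[0, pi])
    (cos (a%:~R * x) ^+ i * cos (b%:~R * x) ^+ j * cos (c%:~R * x) ^+ k *
     cos ((u * a + v * b + w * c)%:~R * x)) =
  cos_moment i u * cos_moment j v * cos_moment k w.
Proof.
rewrite -/(L i j k _).
elim: i u => [|i ih] u le_d; last first.
  rewrite L1 cos_momentS (_ : _ + a = (u + 1) * a + v * b + w * c); last by ring.
  rewrite (_ : _ - a = (u - 1) * a + v * b + w * c); last by ring.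
  by rewrite mulrCA mulrDr !ih; [ring|lia|lia].
elim: j v le_d => [|j ih] v le_d; last first.
  rewrite L2 cos_momentS (_ : _ + b = u * a + (v + 1) * b + w * c); last by ring.
  rewrite (_ : _ - b = u * a + (v - 1) * b + w * c); last by ring.
  by rewrite mulrCA mulrDr !ih; [ring|lia|lia].
elim: k w le_d => [|k ih] w le_d; last first.
  rewrite L3 cos_momentS (_ : _ + c = u * a + v * b + (w + 1) * c); last by ring.
  rewrite (_ : _ - c = u * a + v * b + (w - 1) * c); last by ring.
  by rewrite mulrCA mulrDr !ih; [ring|lia|lia].
have cos_moment0 n : cos_moment 0 n = if n == 0 then pi else 0.
  rewrite -Rintegral_cos_intmul.
  by apply: eq_Rintegral => x _; rewrite expr0 mul1r.
rewrite !cos_moment0 (_ : L 0 0 0 _ =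
  if u * a + v * b + w * c == 0 then pi else 0); last first.
  rewrite -Rintegral_cos_intmul.
  by apply: eq_Rintegral => x _; rewrite !expr0 !mul1r.
(* A zero combined frequency forces u = v = w = 0. Otherwise one of u, v, w is nonzero, and its
   moment annihilates the product. *)
case: eqP => [/(nonresonant le_d)[-> -> ->]|]; first by rewrite eqxx; ring.
have [->|_] := eqVneq u 0; last by rewrite !mul0r mulr0.
have [->|_] := eqVneq v 0; last by rewrite !mulr0 mul0r.
have [->|_] := eqVneq w 0; last by rewrite !mulr0.
by move=> []; rewrite !mul0r !addr0.
Qed.

Corollary Rintegral_lissajous_monomial i j k : (i + j + k <= d)%N ->
  pi ^+ 2 * \int[mu]_(x in `[0, pi])
    (cos (a%:~R * x) ^+ i * cos (b%:~R * x) ^+ j * cos (c%:~R * x) ^+ k) =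
  cos_moment i 0 * cos_moment j 0 * cos_moment k 0.
Proof.
move=> le_d; rewrite -Rintegral_lissajous_moment; last by rewrite !addn0.
congr (_ * _); apply: eq_Rintegral => x _.
by rewrite !mul0r cos0 mulr1.
Qed.

End lissajous_moments.
End CosineMoments.

(** * Integrals of products and linear combinations *)

Section prod_integral.
Local Open Scope ereal_scope.
Context d1 d2 (T1 : measurableType d1) (T2 : measurableType d2) (R : realType).
Variables (m1 : {sigma_finite_measure set T1 -> \bar R}).
Variables (m2 : {sigma_finite_measure set T2 -> \bar R}).

(* The canonical sigma-finite structure of [\x] is only inferred for
   subprobability factors, hence this explicit packing. *)
Lemma sigma_finite_prod : sigma_finite setT (m1 \x m2).
Proof.
exact: (isSigmaFinite.sigma_finiteT
  (lebesgue_integral_fubini.measure_function_Measure_isSigmaFinite__to__measure_function_isSigmaFinite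
    m1 m2)).
Qed.

Definition sigma_finite_product_measure :
    {sigma_finite_measure set (T1 * T2)%type -> \bar R} :=
  HB.pack (m1 \x m2)
    (Measure_isSigmaFinite.Build _ _ _ (m1 \x m2) sigma_finite_prod).

(** The iterated integral of |f| |g| is the product of two finite integrals, which gives joint
    integrability; Fubini then applies to the signed product. *)
Lemma integral_prodT (f : T1 -> R) (g : T2 -> R) :
  m1.-integrable setT (EFin \o f) -> m2.-integrable setT (EFin \o g) ->
  (m1 \x m2).-integrable setT (fun z => (f z.1 * g z.2)%:E) /\
  \int[m1 \x m2]_z (f z.1 * g z.2)%:E =
  \int[m1]_x (f x)%:E * \int[m2]_y (g y)%:E.
Proof.
move=> intf intg.
have mf : measurable_fun setT f.
  by apply/measurable_EFinP; exact: measurable_int intf.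
have mg : measurable_fun setT g.
  by apply/measurable_EFinP; exact: measurable_int intg.
have intfg : (m1 \x m2).-integrable setT (fun z => (f z.1 * g z.2)%:E).
  apply/integrable12ltyP.
    apply/measurable_EFinP; apply: measurable_funM.
      exact: (measurableT_comp mf measurable_fst).
    exact: (measurableT_comp mg measurable_snd).
  have -> : \int[m1]_x \int[m2]_y `|(f (x, y).1 * g (x, y).2)%:E| =
      \int[m1]_x (`|(f x)%:E| * \int[m2]_y `|(g y)%:E|).
    apply: eq_integral => x _.
    rewrite -ge0_integralZl//; last first.
      by apply: measurableT_comp => //; exact/measurable_EFinP.
    by apply: eq_integral => y _; rewrite EFinM abseM.
  rewrite ge0_integralZr//; last 2 first.
  - by apply: measurableT_comp => //; exact/measurable_EFinP.
  - exact: integral_ge0.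
  by apply: lte_mul_pinfty; [exact: integral_ge0| |];
    [apply: integrable_fin_num|apply: integrable_lty] => //;
    exact: integrable_abse.
split => //.
rewrite -integral12_prod_meas1// /fubini_F /=.
have fin_g : \int[m2]_y (g y)%:E \is a fin_num by exact: integrable_fin_num.
rewrite -(fineK fin_g) -integralZr//; apply: eq_integral => x _.
by rewrite (fineK fin_g) -integralZl//; apply: eq_integral => y _;
  rewrite EFinM.
Qed.

Lemma integral_prod (A : set T1) (B : set T2) (f : T1 -> R) (g : T2 -> R) :
  measurable A -> measurable B ->
  m1.-integrable A (EFin \o f) -> m2.-integrable B (EFin \o g) ->
  (m1 \x m2).-integrable (A `*` B) (fun z => (f z.1 * g z.2)%:E) /\
  \int[m1 \x m2]_(z in A `*` B) (f z.1 * g z.2)%:E =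
  \int[m1]_(x in A) (f x)%:E * \int[m2]_(y in B) (g y)%:E.
Proof.
move=> mA mB /(integrable_mkcond _ mA) intf /(integrable_mkcond _ mB) intg.
have patchf : (EFin \o f) \_ A = EFin \o (f \_ A) by rewrite restrict_EFin.
have patchg : (EFin \o g) \_ B = EFin \o (g \_ B) by rewrite restrict_EFin.
have patchfg : (fun z => (f z.1 * g z.2)%:E) \_ (A `*` B) =
    (fun z => ((f \_ A) z.1 * (g \_ B) z.2)%:E).
  (* Extension by zero commutes with the product, which reduces the rectangle to the whole space. *)
  apply/funext => -[x y]; rewrite /patch /= in_setX/=.
  by case: (x \in A); case: (y \in B); rewrite ?mul0r ?mulr0.
rewrite patchf in intf; rewrite patchg in intg.
have [intfg fgE] := integral_prodT intf intg.
split; first by apply/integrable_mkcond; [exact: measurableX|rewrite patchfg].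
by rewrite integral_mkcond patchfg fgE; congr (_ * _);
  rewrite [RHS]integral_mkcond ?patchf ?patchg.
Qed.
End prod_integral.

Lemma integral_prod3 d1 d2 d3 (T1 : measurableType d1) (T2 : measurableType d2)
    (T3 : measurableType d3) (R : realType)
    (m1 : {sigma_finite_measure set T1 -> \bar R})
    (m2 : {sigma_finite_measure set T2 -> \bar R})
    (m3 : {sigma_finite_measure set T3 -> \bar R})
    (A : set T1) (B : set T2) (C : set T3)
    (f : T1 -> R) (g : T2 -> R) (h : T3 -> R) :
  measurable A -> measurable B -> measurable C ->
  m1.-integrable A (EFin \o f) -> m2.-integrable B (EFin \o g) ->
  m3.-integrable C (EFin \o h) ->
  ((m1 \x m2) \x m3)%E.-integrable (A `*` B `*` C)
    (fun z => (f z.1.1 * g z.1.2 * h z.2)%:E) /\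
  (\int[(m1 \x m2) \x m3]_(z in A `*` B `*` C) (f z.1.1 * g z.1.2 * h z.2)%:E =
   \int[m1]_(x in A) (f x)%:E * \int[m2]_(y in B) (g y)%:E *
   \int[m3]_(z in C) (h z)%:E)%E.
Proof.
move=> mA mB mC intf intg inth.
have [int2 E2] := integral_prod mA mB intf intg.
have [int3 E3] := @integral_prod _ _ _ _ R
  (sigma_finite_product_measure m1 m2) m3 _ _ (fun z => f z.1 * g z.2) h
  (measurableX mA mB) mC int2 inth.
by split; [exact: int3|rewrite E3 E2].
Qed.

Lemma integral_linear_combination d (T : measurableType d) (R : realType)
    (mu : {measure set T -> \bar R}) (D : set T) (I : Type) (s : seq I)
    (c : I -> R) (f : I -> T -> R) :
  measurable D -> (forall i, mu.-integrable D (EFin \o f i)) ->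
  (\int[mu]_(x in D) (\sum_(i <- s) c i * f i x)%R%:E =
   \sum_(i <- s) (c i)%:E * \int[mu]_(x in D) (f i x)%:E)%E.
Proof.
move=> mD intf.
transitivity (\int[mu]_(x in D) (\sum_(i <- s) (c i)%:E * (f i x)%:E)%E)%E.
  by apply: eq_integral => x _; rewrite -sumEFin; apply: eq_bigr => i _;
    rewrite EFinM.
rewrite integral_sum//; last by move=> i; apply: integrableZl => //; exact: intf.
by apply: eq_bigr => i _; rewrite integralZl//; exact: intf.
Qed.

(** * The Chebyshev weight *)

Section ArcsineWeight.
Variable R : realType.
Local Notation mu := (@lebesgue_measure R).

(** The one-dimensional Chebyshev weight. It is 0 for |t| >= 1, since both the square root of a
    nonpositive number and the inverse of 0 are 0. *)
Definition arcsine_weight (t : R) : R := (Num.sqrt (1 - t ^+ 2))^-1.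

Lemma arcsine_weight_ge0 t : 0 <= arcsine_weight t.
Proof. by rewrite invr_ge0 sqrtr_ge0. Qed.

Lemma continuous_arcsine_weight t : -1 < t < 1 ->
  {for t, continuous arcsine_weight}.
Proof.
move=> t1; apply: continuousV.
  by rewrite sqrtr_eq0 -ltNge subr_gt0; nra.
apply: (@continuous_comp _ _ _ (fun t : R => 1 - t ^+ 2) (@Num.sqrt R)).
  by apply: cvgB; [exact: cst_continuous|exact: exprn_continuous].
exact: sqrt_continuous.
Qed.

(** The Jacobian of t = cos x cancels the weight; positivity of sin removes the absolute value from
    the square root of sin^2. *)
Lemma arcsine_weight_cos x : 0 < x < pi ->
  arcsine_weight (cos x) * sin x = 1.
Proof.
move=> xpi; have s0 := sin_gt0_pi xpi.
by rewrite /arcsine_weight -sin2cos2 sqrtr_sqr gtr0_norm// mulVf// gt_eqF.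
Qed.

Lemma nondecreasing_segments (A B : nat -> R) :
  (forall m n, (m <= n)%N -> A n <= A m) ->
  (forall m n, (m <= n)%N -> B m <= B n) ->
  nondecreasing_seq (fun n => `[A n, B n]%classic).
Proof.
move=> An Bn m n mn; apply/subsetPset => x /=; rewrite !in_itv/= => /andP[mx xm].
by rewrite (le_trans (An _ _ mn) mx) (le_trans xm (Bn _ _ mn)).
Qed.

(** Monotone convergence along compact segments exhausting the open interval. It serves integrands
    that may be unbounded at a and b. *)
Lemma integral_segments_cvg (A B : nat -> R) (a b : R) (h : R -> R) :
  (forall n, a < A n /\ B n < b) ->
  (forall m n, (m <= n)%N -> A n <= A m) ->
  (forall m n, (m <= n)%N -> B m <= B n) ->
  (forall x, a < x < b -> exists n, A n <= x <= B n) ->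
  {in `]a, b[, continuous h} -> (forall x, a < x < b -> 0 <= h x) ->
  (\int[mu]_(x in `[A n, B n]) (h x)%:E @[n --> \oo] -->
   \int[mu]_(x in `[a, b]) (h x)%:E)%E.
Proof.
move=> AB Adecr Bincr cover ch h0.
have mh : measurable_fun `]a, b[ h.
  apply: open_continuous_measurable_fun; first exact: interval_open.
  by move=> x /set_mem /ch.
have subAB n x : A n <= x <= B n -> a < x < b.
  by have [aA Bb] := AB n => /andP[Ax xB];
    rewrite (lt_le_trans aA)//= (le_lt_trans xB).
(* The endpoints form a null set, so only the open interval, where h is continuous, matters. *)
rewrite integral_itv_bndoo; last exact/measurable_EFinP.
have -> : `]a, b[%classic = \bigcup_n `[A n, B n]%classic.
  apply/seteqP; split=> x /=; rewrite in_itv/=.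
    by move=> /cover[n xn]; exists n => //=; rewrite in_itv.
  by move=> [n _] /=; rewrite in_itv/= => /subAB.
apply: ge0_nondecreasing_set_cvg_integral.
- exact: nondecreasing_segments.
- by move=> n; exact: measurable_itv.
- move=> n; apply/measurable_EFinP; apply: measurable_funS mh => //.
  by move=> x /=; rewrite !in_itv/=; exact: subAB.
- by move=> n x /=; rewrite in_itv/= lee_fin => /subAB; exact: h0.
Qed.

(* The weight is unbounded at the endpoints, so the substitution is carried out
   on the segments [cos (pi - e_n), cos e_n] and followed by monotone
   convergence. *)
Lemma ge0_integral_arcsine_weight (f : R -> R) : continuous f ->
  (forall t, -1 <= t <= 1 -> 0 <= f t) ->
  (\int[mu]_(t in `[(-1)%R, 1%R]) (f t * arcsine_weight t)%:E =
   \int[mu]_(x in `[0%R, pi]) (f (cos x))%:E)%E.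
Proof.
move=> cf f0.
(* The denominator is at least 3, so e n < pi / 2 and the segments are nondegenerate already at n =
   0. *)
pose e n : R := pi / n.+3%:R.
have pi0 := pi_gt0 R.
have e0 n : 0 < e n by rewrite divr_gt0.
have epi n : e n < pi - e n.
  have eK : e n * n.+3%:R = pi by rewrite divfK.
  have : 3 <= n.+3%:R :> R by rewrite ler_nat.
  by have := e0 n; nra.
have edecr : forall m n, (m <= n)%N -> e n <= e m.
  by move=> m n mn; rewrite ler_pM2l// lef_pV2 ?posrE// ler_nat.
have eitv n x : e n <= x <= pi - e n -> 0 < x < pi by have := e0 n; lra.
have ein n x : e n <= x <= pi - e n -> x \in `[0, pi].
  by move=> /eitv/andP[x0 xpi]; rewrite in_itv/= !ltW.
have cosE : derive1 (@cos R) = fun x => - sin x.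
  by apply/funext => x; rewrite derive1E derive_val.
have csin : continuous (fun x : R => - sin x).
  by move=> x; apply: cvgN; exact: continuous_sin.
pose A n := cos (pi - e n); pose B n := cos (e n).
have enin n : e n \in `[0, pi] by apply: (ein n); have := epi n; lra.
have pienin n : pi - e n \in `[0, pi] by apply: (ein n); have := epi n; lra.
have cosle (x y : R) : x \in `[0, pi] -> y \in `[0, pi] ->
    x <= y -> cos y <= cos x.
  by move=> xin yin; rewrite !leNgt ltr_cos.
have zin : (0 : R) \in `[0, pi] by rewrite in_itv/=; lra.
have pin : (pi : R) \in `[0, pi] by rewrite in_itv/=; lra.
have ABo n : -1 < A n /\ B n < 1.
  split; [rewrite -[X in X < _](@cospi R)|rewrite -[X in _ < X](@cos0 R)];
    by rewrite ltr_cos//; have := e0 n; lra.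
have AB1 n t : A n <= t <= B n -> -1 < t < 1.
  by have := ABo n; lra.
have mem_arcs (x : R) : -1 < x < 1 -> 0 < acos x < pi.
  by move=> x1; rewrite acos_gt0 ?acos_ltpi//; lra.
have cover (x : R) : 0 < x < pi -> exists n, e n <= x <= pi - e n.
  move=> xpi; pose m := Num.min x (pi - x).
  have m0 : 0 < m / pi by rewrite divr_gt0// lt_min; lra.
  (* Here m is the distance from x to the endpoints; choosing pi / (n + 1) < m suffices, since e n
     <= pi / (n + 1). *)
  have [n _ /(_ n (leqnn n))] := near_infty_natSinv_lt (PosNum m0).
  rewrite /= ltr_pdivlMr// => nm; exists n.
  have : e n <= m.
    rewrite (le_trans _ (ltW nm))// mulrC ler_pM2l// lef_pV2 ?posrE// ler_nat.
    by rewrite ltnW.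
  by rewrite le_min; lra.
have substE n : (\int[mu]_(t in `[A n, B n]) (f t * arcsine_weight t)%:E =
    \int[mu]_(x in `[e n, (pi - e n)%R]) (f (cos x))%:E)%E.
  rewrite (@integration_by_substitution_decreasing _ (@cos R)); first last.
  - apply: continuous_in_subspaceT => t; rewrite inE/= in_itv/= => /AB1 t1.
    by apply: continuousM; [exact: cf|exact: continuous_arcsine_weight].
  - split=> [x _||]; first exact: derivable_cos.
      by apply: cvg_at_right_filter; exact: continuous_cos.
    by apply: cvg_at_left_filter; exact: continuous_cos.
  - rewrite cosE; apply: cvgP; apply: cvg_at_left_filter; exact: csin.
  - rewrite cosE; apply: cvgP; apply: cvg_at_right_filter; exact: csin.
  - by rewrite cosE => x _; exact: csin.
  - move=> x y xin yin; rewrite ltr_cos//.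
      by apply: (ein n); rewrite in_itv in xin.
    by apply: (ein n); rewrite in_itv in yin.
  - exact: ltW.
  apply: eq_integral => x; rewrite inE/= in_itv/= => /eitv xpi.
  (* A decreasing substitution carries minus the derivative of cos; unfolding the pointwise
     operations on functions exposes the double sign in - (- sin x). *)
  rewrite cosE /GRing.mul /= /GRing.opp /= -/(GRing.opp _) opprK.
  by rewrite -mulrA arcsine_weight_cos// mulr1.
have cvgl : (\int[mu]_(t in `[A n, B n]) (f t * arcsine_weight t)%:E 
   @[n --> \oo] --> \int[mu]_(t in `[(-1)%R, 1%R]) (f t * arcsine_weight t)%:E)%E.
  apply: (@integral_segments_cvg A B (-1) 1 (fun t => f t * arcsine_weight t)).
  + exact: ABo.
  + by move=> m n mn; apply: cosle => //; rewrite lerD2l lerN2; exact: edecr.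
  + by move=> m n mn; apply: cosle => //; exact: edecr.
  (* The point acos x lies in some [e n, pi - e n], and cos, being decreasing, sends it back into
     [A n, B n]. *)
  + move=> x x1; have [n en] := cover _ (mem_arcs _ x1); exists n.
    have acn := ein _ _ en; have xK : cos (acos x) = x.
      by rewrite acosK// in_itv/=; lra.
    by rewrite -xK /A /B !cosle//; lra.
  + move=> x; rewrite in_itv/= => /continuous_arcsine_weight cw.
    by apply: continuousM => //; exact: cf.
  + by move=> x x1; rewrite mulr_ge0 ?arcsine_weight_ge0// f0//; lra.
have cvgr : (\int[mu]_(x in `[e n, (pi - e n)%R]) (f (cos x))%:E 
   @[n --> \oo] --> \int[mu]_(x in `[0%R, pi]) (f (cos x))%:E)%E.
  apply: (@integral_segments_cvg e (fun n => pi - e n) 0 pi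
    (fun x => f (cos x))) => //.
  + by move=> n; have := e0 n; lra.
  + by move=> m n mn; rewrite lerD2l lerN2; exact: edecr.
  + move=> x _; apply: (@continuous_comp _ _ _ (@cos R) f); last exact: cf.
    exact: continuous_cos.
  + by move=> x _; rewrite f0// cos_geN1 cos_le1.
by rewrite -(cvg_lim _ cvgl)// -(cvg_lim _ cvgr)//; congr (limn _);
  apply/funext.
Qed.

Lemma measurable_arcsine_weight :
  measurable_fun (`[-1, 1]%classic : set R) arcsine_weight.
Proof.
(* The flags [false true] denote the open interval: adding the two endpoints preserves
   measurability. *)
apply: (@measurable_fun_itv_cc _ _ _ false true).
apply: open_continuous_measurable_fun; first exact: interval_open.
by move=> x /set_mem/=; rewrite in_itv/=; exact: continuous_arcsine_weight.
Qed.

(** For a nonnegative integrand the substitution evaluates the integral of the absolute value: it is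
    that of the continuous function f (cos x) over a compact segment, hence finite. *)
Lemma ge0_integrable_arcsine_weight (f : R -> R) : continuous f ->
  (forall t, -1 <= t <= 1 -> 0 <= f t) ->
  mu.-integrable `[-1, 1] (fun t => (f t * arcsine_weight t)%:E).
Proof.
move=> cf f0; apply/integrableP; split.
  apply/measurable_EFinP; apply: measurable_funM;
    last exact: measurable_arcsine_weight.
  exact: measurable_funTS (continuous_measurable_fun cf).
have absE : (\int[mu]_(t in `[(-1)%R, 1%R]) `|(f t * arcsine_weight t)%:E| <=
    \int[mu]_(x in `[0%R, pi]) (f (cos x))%:E)%E.
  rewrite -ge0_integral_arcsine_weight// le_eqVlt; apply/orP; left; apply/eqP.
  apply: eq_integral => t /set_mem/=; rewrite in_itv/= => t1.
  by rewrite ger0_norm// mulr_ge0 ?f0 ?arcsine_weight_ge0.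
apply: (le_lt_trans absE); apply: integrable_lty => //.
apply: continuous_compact_integrable; first exact: segment_compact.
apply: continuous_subspaceT => x; apply: (@continuous_comp _ _ _ (@cos R) f).
  exact: continuous_cos.
exact: cf.
Qed.

(* Writing t^i = (t^i + 1) - 1 reduces to nonnegative integrands. *)
Lemma integral_expr_arcsine_weight i :
  mu.-integrable `[-1, 1] (fun t => (t ^+ i * arcsine_weight t)%:E) /\
  (\int[mu]_(t in `[(-1)%R, 1%R]) (t ^+ i * arcsine_weight t)%:E =
   (\int[mu]_(x in `[0, pi]) (cos x ^+ i))%R%:E)%E.
Proof.
have c1 : continuous (fun _ : R => 1 : R) by move=> ?; exact: cvg_cst.
have ci : continuous (fun t : R => t ^+ i + 1 : R).
  by move=> x; apply: cvgD; [exact: exprn_continuous|exact: cvg_cst].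
have p1 (t : R) : -1 <= t <= 1 -> 0 <= (1 : R) by [].
have pi_ (t : R) : -1 <= t <= 1 -> 0 <= t ^+ i + 1.
  move=> t1; have : `|t ^+ i| <= 1.
    by rewrite normrX exprn_ile1// ler_norml.
  by rewrite ler_norml; lra.
have int1 := ge0_integrable_arcsine_weight c1 p1.
have inti := ge0_integrable_arcsine_weight ci pi_.
have E (t : R) : (t ^+ i * arcsine_weight t)%:E =
    (((t ^+ i + 1) * arcsine_weight t)%:E - (1 * arcsine_weight t)%:E)%E.
  by rewrite -EFinB; congr EFin; ring.
split.
  rewrite (_ : (fun t => _) = (fun t => ((t ^+ i + 1) * arcsine_weight t)%:E) \-
    (fun t => (1 * arcsine_weight t)%:E))%E; last first.
    by apply/funext => t; exact: E.
  exact: integrableB.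
under eq_integral do rewrite E.
rewrite integralB//= !ge0_integral_arcsine_weight// -integralB//=; last 2 first.
- apply: continuous_integrable_itv => x; apply: cvgD.
    by apply: continuous_expn; exact: continuous_cos.
  exact: cvg_cst.
- exact: continuous_integrable_itv.
rewrite fineK; last first.
  apply: integrable_fin_num => //.
  by apply: continuous_integrable_itv; apply: continuous_expn;
    exact: continuous_cos.
by apply: eq_integral => x _; rewrite -EFinB; congr EFin; ring.
Qed.
End ArcsineWeight.

(** * From monomials to polynomials on the cube *)

Lemma lissajous_freqs_nonresonant (R : realType) (n : nat) : (1 <= n)%N ->
  exists a b c : int,
    [/\ freq_a R n = a%:~R, freq_b R n = b%:~R, freq_c R n = c%:~R &
     forall u v w : int, (`|u| + `|v| + `|w| <= 2 * n)%N ->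
       u * a + v * b + w * c = 0 -> [/\ u = 0, v = 0 & w = 0]].
Proof.
move=> n1; have := odd_double_half n; rewrite /freq_a /freq_b /freq_c -mul2n.
case: (odd n); rewrite /nat_of_bool; move: n./2 => m nE.
(* For odd n = 2 m + 1 the shift k = m + 1 gives n = 2 k - 1, so 2 n is the bound 4 k - 2 of
   [nonresonance_odd], and k >= 1. *)
- pose k : int := m.+1.
  exists (3 * (k * k) - 3 * k + 1), (3 * (k * k) - 1), (3 * (k * k)).
  have nR : n%:R = 2 * k%:~R - 1 :> R.
    by rewrite -nE natrD natrM /k -pmulrn mulrSr; ring.
  rewrite !(intrD, intrM, intrB) nR; split; [by field..|].
  by move=> u v w le_n; apply: nonresonance_odd; rewrite /k; lia.
- pose k : int := m.
  exists (3 * (k * k) + k), (3 * (k * k) + 2 * k), (3 * (k * k) + 3 * k + 1).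
  have nR : n%:R = 2 * k%:~R :> R by rewrite -nE natrM.
  rewrite !(intrD, intrM) nR; split; [by field..|].
  by move=> u v w le_n; apply: nonresonance_even; rewrite /k; lia.
Qed.

(** On the cube the three factors under the root are nonnegative, so the root is multiplicative.
    Outside it, two negative factors may have a positive product while their separate roots are
    0. *)
Lemma chebyshev_weight_prod (R : realType) (x : R * R * R) : cube R x ->
  chebyshev_weight x =
  arcsine_weight x.1.1 * arcsine_weight x.1.2 * arcsine_weight x.2.
Proof.
case: x => -[x y] z [[/=]]; rewrite !in_itv/= => x1 y1 z1.
rewrite /chebyshev_weight /arcsine_weight /x1 /x2 /x3 /= -!invfM.
have ge0 (t : R) : -1 <= t <= 1 -> 0 <= 1 - t ^+ 2 by nra.
by rewrite !sqrtrM ?mulr_ge0 ?ge0.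
Qed.

Lemma integral_chebyshev_monomial (R : realType) (i j k : nat) :
  (lebesgue_measure3 R).-integrable (cube R) (fun x =>
    (x.1.1 ^+ i * x.1.2 ^+ j * x.2 ^+ k * chebyshev_weight x)%:E) /\
  (\int[lebesgue_measure3 R]_(x in cube R)
    (x.1.1 ^+ i * x.1.2 ^+ j * x.2 ^+ k * chebyshev_weight x)%:E =
   (cos_moment R i 0 * cos_moment R j 0 * cos_moment R k 0)%:E)%E.
Proof.
have wE i' := @integral_expr_arcsine_weight R i'.
have cE i' : cos_moment R i' 0 =
    \int[@lebesgue_measure R]_(x in `[0, pi]) (cos x ^+ i').
  by apply: eq_Rintegral => x _; rewrite mul0r cos0 mulr1.
rewrite !cE.
pose w (l : nat) (t : R) : R := t ^+ l * arcsine_weight t.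
have mI : measurable (`[-1, 1]%classic : set (measurableTypeR R)).
  exact: measurable_itv.
have [int3 E3] := @integral_prod3 _ _ _ _ _ _ R
  lebesgue_measure lebesgue_measure lebesgue_measure _ _ _ (w i) (w j) (w k)
  mI mI mI (wE i).1 (wE j).1 (wE k).1.
have E x : cube R x ->
  (x.1.1 ^+ i * x.1.2 ^+ j * x.2 ^+ k * chebyshev_weight x)%:E =
  (x.1.1 ^+ i * arcsine_weight x.1.1 * (x.1.2 ^+ j * arcsine_weight x.1.2) *
   (x.2 ^+ k * arcsine_weight x.2))%:E.
  by move=> /chebyshev_weight_prod ->; congr EFin; ring.
split.
  apply: eq_integrable int3; first exact: measurableX (measurableX mI mI) mI.
  by move=> x /set_mem xc; rewrite E.
rewrite !EFinM -!(wE _).2 -E3.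
by apply: eq_integral => x /set_mem; exact: E.
Qed.

(** Reconciles the lifted indices produced by [big_ord_recl] with the [inord] indices used for
    exponents. *)
Lemma ord3_1 : lift ord0 ord0 = inord 1 :> 'I_3.
Proof. by apply/val_inj; rewrite /= inordK. Qed.

Lemma ord3_2 : lift ord0 (lift ord0 ord0) = inord 2 :> 'I_3.
Proof. by apply/val_inj; rewrite /= inordK. Qed.

Lemma eval3E (R : realType) (p : mpoly.mpoly 3 R) (x : R * R * R) :
  eval3 p x = \sum_(m <- msupp p) mcoeff m p *
    (x.1.1 ^+ m ord0 * x.1.2 ^+ m (inord 1) * x.2 ^+ m (inord 2)).
Proof.
rewrite /eval3 mevalE; apply: eq_bigr => m _; congr (_ * _).
rewrite !big_ord_recl big_ord0 mulr1 mulrA /x1 /x2 /x3.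
rewrite ord3_1 ord3_2.
by rewrite !(tnth_nth 0) /= !inordK.
Qed.

Unset Implicit Arguments.
Set Strict Implicit.

Theorem proposition1 (R : realType) (n : nat) (hn : (1 <= n)%N)
    (p : mpoly.mpoly 3 R) (hp : deg_le (2 * n) p) :
  (\int[lebesgue_measure3 R]_(x in cube R)
      (eval3 p x * chebyshev_weight x)%:E =
   (pi ^+ 2)%:E *
   \int[@lebesgue_measure R]_(theta in `[0%R, pi])
      (eval3 p (lissajous n theta))%:E)%E.
Proof.
have [a [b [c [aE bE cE nonres]]]] := lissajous_freqs_nonresonant R hn.
pose mono (m : mpoly.multinom 3) (x : R * R * R) : R :=
  x.1.1 ^+ m ord0 * x.1.2 ^+ m (inord 1) * x.2 ^+ m (inord 2).
pose leb := @lebesgue_measure R.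
have mI : measurable (`[-1, 1]%classic : set (measurableTypeR R)).
  exact: measurable_itv.
have chebE (m : mpoly.multinom 3) :=
  integral_chebyshev_monomial R (m ord0) (m (inord 1)) (m (inord 2)).
have chebp := @integral_linear_combination _ _ R (lebesgue_measure3 R) (cube R) _
  (msupp p) (fun m => mcoeff m p) (fun m x => mono m x * chebyshev_weight x)
  (measurableX (measurableX mI mI) mI) (fun m => (chebE m).1).
have mP : measurable (`[0, pi]%classic : set (measurableTypeR R)).
  exact: measurable_itv.
have intL m : leb.-integrable `[0, pi] (fun x => (mono m (lissajous n x))%:E).
  rewrite /mono /lissajous aE bE cE /=.
  apply: continuous_integrable_itv.
  by do ![apply: continuous_mul]; apply: continuous_expn; exact: continuous_cosM.
have lissp := @integral_linear_combination _ _ R leb _ _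
  (msupp p) (fun m => mcoeff m p) (fun m x => mono m (lissajous n x))
  mP intL.
apply: (etrans (etrans _ chebp)).
  apply: eq_integral => x _; congr EFin; rewrite eval3E mulr_suml.
  by apply: eq_bigr => m _; rewrite mulrA.
have liss_sum : (\int[@lebesgue_measure R]_(theta in `[0%R, pi])
    (eval3 p (lissajous n theta))%:E =
    \int[@lebesgue_measure R]_(theta in `[0%R, pi])
    (\sum_(m <- msupp p) mcoeff m p * mono m (lissajous n theta))%R%:E)%E.
  by apply: eq_integral => x _; rewrite eval3E.
rewrite (etrans liss_sum lissp).
under eq_bigr => m _ do rewrite (chebE m).2 -EFinM.
(* The integrals along the curve are finite, so the identity can be moved from extended reals to
   reals. *)
under [in RHS]eq_bigr => m _.
  rewrite -(fineK (integrable_fin_num mP (intL m))) -EFinM.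
  over.
rewrite !sumEFin -EFinM; congr EFin; rewrite mulr_sumr.
(* Each monomial of the support has degree below [msize p], hence below 2 n + 1, that is, at most 2
   n. *)
apply: eq_big_seq => m /msize_mdeg_lt/leq_trans/(_ hp).
rewrite mdegE !big_ord_recl big_ord0 addn0 ltnS addnA.
rewrite ord3_1 ord3_2 => deg_m.
rewrite [RHS]mulrCA; congr (_ * _).
rewrite -(Rintegral_lissajous_monomial R nonres)//; congr (_ * _).
by apply: eq_Rintegral => x _; rewrite /mono /lissajous aE bE cE.
Qed.
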